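(* Let $T>0$, let $u,v\in H^1((0,T);\mathcal V)\cap C^0([0,T];\mathcal V)$ and $\beta,\gamma:[0,T]\to\mathcal V$ be such that for all $i\in V$ and all $t\in(0,T)$, $0\le u_i(t)\le1$ and $0\le v_i(t)\le1$, and for a.e. $t\in(0,T)$ and all $i\in V$ $$\varepsilon\frac{du_i}{dt}+\varepsilon(\Delta u(t))_i+\tfrac12-u_i(t)\ge\beta_i(t),\qquad\beta(t)\in\mathcal B(u(t)),$$ $$\varepsilon\frac{dv_i}{dt}+\varepsilon(\Delta v(t))_i+\tfrac12-v_i(t)\le\gamma_i(t),\qquad\gamma(t)\in\mathcal B(v(t)).$$ If $v_i(0)\le u_i(0)$ for all $i\in V$, then $v_i(t)\le u_i(t)$ for all $t\in[0,T]$ and all $i\in V$.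
   Context: Let $G=(V,E)$ be a finite, undirected, simple, connected graph with symmetric weights $\omega_{ij}=\omega_{ji}$, $\omega_{ij}>0$ for $ij\in E$ and $\omega_{ij}=0$ for $ij\notin E$. Let $d_i=\sum_{j}\omega_{ij}>0$ be the degree of $i\in V$. Fix $r\in[0,1]$ and $\varepsilon>0$. Let $\mathcal V=\{u:V\to\mathbb R\}$ and, for $X\subseteq\mathbb R$, $\mathcal V_X=\{u:V\to X\}$; $\mathcal V$ carries the inner product $\langle u,v\rangle_{\mathcal V}=\sum_{i\in V}u_iv_id_i^r$. The graph Laplacian is $(\Delta u)_i=d_i^{-r}\sum_{j\in V}\omega_{ij}(u_i-u_j)$. For an open interval $I$, $H^1(I;\mathcal V)$ is the set of $u\in L^2(I;\mathcal V)$ with generalised (weak) time derivative $du/dt\in L^2(I;\mathcal V)$. For $u\in\mathcal V_{[0,1]}$, $\mathcal B(u)$ is the set of $\alpha\in\mathcal V$ such that for each $i\in V$: $\alpha_i\ge0$ if $u_i=0$, $\alpha_i=0$ if $0<u_i<1$, and $\alpha_i\le0$ if $u_i=1$. *)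

(* Defs.v *)
From HB Require Import structures.
From mathcomp Require Import all_boot all_order all_algebra.
From mathcomp Require Import all_classical all_reals all_analysis.

Set Implicit Arguments.
Unset Strict Implicit.
Unset Printing Implicit Defensive.

Import Order.TTheory GRing.Theory Num.Theory.
Import numFieldNormedType.Exports.

Local Open Scope classical_set_scope.
Local Open Scope ring_scope.

Record wgraph (R : realType) := WGraph {
  vertex :> finType;
  edge : rel vertex;
  weight : vertex -> vertex -> R;
  edge_sym : symmetric edge;
  edge_irr : irreflexive edge;
  edge_conn : forall i j, connect edge i j;
  weight_sym : forall i j, weight i j = weight j i;
  weight_gt0 : forall i j, edge i j -> 0 < weight i j;
  weight_eq0 : forall i j, ~~ edge i j -> weight i j = 0;
  (* excludes the graph with a single vertex *)
  degree_gt0 : forall i, 0 < \sum_j weight i j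
}.

Definition degree (R : realType) (G : wgraph R) (i : G) : R :=
  \sum_j weight i j.

Definition vdot (R : realType) (G : wgraph R) (r : R) (u v : G -> R) : R :=
  \sum_i u i * v i * degree i `^ r.

Definition laplacian (R : realType) (G : wgraph R) (r : R) (u : G -> R)
    (i : G) : R :=
  degree i `^ (- r) * \sum_j weight i j * (u i - u j).

(* Time-dependent functions are total maps [R -> G -> R]; only their
   restriction to the interval [I] matters.  Elements of L^2 are given by
   Borel representatives. *)
Definition L2 (R : realType) (G : wgraph R) (r : R) (I : set R)
    (u : R -> G -> R) : Prop :=
  (forall i, measurable_fun I (fun t => u t i)) /\
  (\int[lebesgue_measure]_(t in I) (vdot r (u t) (u t))%:E < +oo)%E.

(* C_c^oo(I; V): functions smooth on the whole line whose support is a compact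
   subset of the open interval [I]. *)
Definition test_function (R : realType) (G : wgraph R) (I : set R)
    (phi : R -> G -> R) : Prop :=
  (forall (i : G) (n : nat) (t : R),
     derivable (derive1n n (fun s => phi s i)) t 1) /\
  (exists K : set R, [/\ compact K, K `<=` I &
     forall t, ~ K t -> forall i, phi t i = 0]).

Definition time_derive (R : realType) (G : wgraph R) (phi : R -> G -> R) :
    R -> G -> R :=
  fun t i => derive1 (fun s => phi s i) t.

Definition weak_derivative (R : realType) (G : wgraph R) (r : R) (I : set R)
    (u du : R -> G -> R) : Prop :=
  L2 r I du /\
  forall phi : R -> G -> R, test_function I phi ->
    \int[lebesgue_measure]_(t in I) vdot r (u t) (time_derive phi t) =
    - \int[lebesgue_measure]_(t in I) vdot r (du t) (phi t).

Definition H1 (R : realType) (G : wgraph R) (r : R) (I : set R)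
    (u : R -> G -> R) : Prop :=
  L2 r I u /\ exists du : R -> G -> R, weak_derivative r I u du.

(* [V] carries its finite-dimensional topology, i.e. the product topology on
   [G -> R]. *)
Definition C0 (R : realType) (G : wgraph R) (I : set R) (u : R -> G -> R) :
    Prop :=
  {within I, continuous (u : R -> {ptws G -> R})}.

Definition Bset (R : realType) (G : wgraph R) (u : G -> R) : set (G -> R) :=
  [set alpha | forall i : G,
     [/\ u i = 0 -> 0 <= alpha i,
         0 < u i < 1 -> alpha i = 0 &
         u i = 1 -> alpha i <= 0]].

(* Main.v *)
Require Import Defs.
From HB Require Import structures.
From mathcomp Require Import all_boot all_order all_algebra.
From mathcomp Require Import all_classical all_reals all_analysis.
From mathcomp Require Import measurable_realfun ring lra.

Set Implicit Arguments.
Unset Strict Implicit.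
Unset Printing Implicit Defensive.

Import Order.TTheory GRing.Theory Num.Theory.
Import numFieldNormedType.Exports.

Local Open Scope classical_set_scope.
Local Open Scope ring_scope.

(** The difference w = v - u obeys a linear differential inequality wherever it
    is positive, and a maximum principle on the finite vertex set then keeps it
    nonpositive.

    If w_i(t) > 0 then u_i(t) < v_i(t), so u_i(t) < 1 and v_i(t) > 0; the sign
    conditions on the obstacle multipliers give beta_i(t) >= 0 >= gamma_i(t).
    Subtracting the two differential inequalities, the multipliers drop out, and
    bounding the graph Laplacian of w crudely gives
    dw_i/dt <= K * max_j w_j(t) with K depending only on eps, r and the graph
    ([obstacle_rate_le]).

    The comparison itself is a short-time argument ([weak_maximum_principle]).
    If w <= 0 up to a time s0, let S > 0 be the maximum over the vertices of w
    up to some time t <= s0 + 1/(2K), attained at a vertex j and a time c, and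
    let s be the last time before c with w_j(s) <= 0.  On ]s, c[ the component
    w_j is positive and its derivative is at most K * S, so
    S <= K * S * (c - s) <= S / 2, which is absurd.  Steps of length 1/(2K)
    exhaust [0, T].

    The one analytic ingredient is that a continuous function whose weak
    derivative is at most C >= 0 a.e. on ]a, b[ grows by at most C * (b - a) there
    ([weak_mean_value_le]).  It follows from the definition of weak derivative
    by testing against a smooth plateau, equal to 1 on most of ]a, b[ and
    vanishing outside: the derivative of the plateau is a difference of two
    bumps of integral 1, which average the function near a and near b.  The
    plateau is a difference of two smooth steps built from exp(-1/x). *)

(** * A smooth step function *)

Section smooth_step.
Context {R : realType}.
Implicit Types (f g : R -> R) (n : nat) (x : R).

(** [n]-fold differentiability, with the derivative supplied as a witness: in
    this form each closure property is an induction on [n] in which only the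
    derivative of the function at hand is computed. *)
Fixpoint ndiff n f : Prop :=
  if n is m.+1 then exists2 g, (forall x, is_derive x 1 f (g x)) & ndiff m g
  else True.

Lemma ndiffW n f : ndiff n.+1 f -> ndiff n f.
Proof.
elim: n f => // n IH f [g fg /IH sg]; by exists g.
Qed.

Lemma ndiff_derivable n f :
  ndiff n.+1 f -> forall x, derivable (derive1n n f) x 1.
Proof.
elim: n f => [|n IH] f [g fg sg]; first by move=> x; case: (fg x).
move=> x; rewrite derive1Sn; suff -> : derive1 f = g by exact: IH.
by apply/funext => y; rewrite derive1E derive_val.
Qed.

Lemma ndiff_cst n (c : R) : ndiff n (fun=> c).
Proof.
elim: n c => //= n IH c; exists (fun=> 0); last exact: IH.
by move=> x; exact: is_derive_cst.
Qed.

Lemma ndiffD n f g : ndiff n f -> ndiff n g -> ndiff n (f \+ g).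
Proof.
elim: n f g => // n IH f g [f' df sf] [g' dg sg].
by exists (f' \+ g'); [move=> x; exact: is_deriveD|exact: IH].
Qed.

Lemma ndiffM n f g : ndiff n f -> ndiff n g -> ndiff n (f \* g).
Proof.
elim: n f g => // n IH f g /[dup] /ndiffW sf0 [f' df sf].
move=> /[dup] /ndiffW sg0 [g' dg sg].
exists ((f \* g') \+ (g \* f')); last by apply: ndiffD; exact: IH.
by move=> x; exact: is_deriveM.
Qed.

Lemma ndiffV n f : (forall x, f x != 0) -> ndiff n f ->
  ndiff n (fun x => (f x)^-1).
Proof.
move=> f0; elim: n => // n IH /[dup] /ndiffW sf [f' df sf'].
exists ((fun=> -1) \* (((fun x => (f x)^-1) \* (fun x => (f x)^-1)) \* f')).
  move=> x; apply: is_derive_eq (is_deriveV (f0 x) (df x)) _.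
  by rewrite /= /GRing.scale/= mulN1r mulNr expr2 invfM.
by do !apply: ndiffM => //; [exact: ndiff_cst|exact: IH|exact: IH].
Qed.

Lemma ndiff_affine n f (a b : R) :
  ndiff n f -> ndiff n (fun x => f (a * x + b)).
Proof.
elim: n f => // n IH f [f' df sf].
exists ((fun=> a) \* (fun x => f' (a * x + b))); last first.
  by apply: ndiffM; [exact: ndiff_cst|exact: IH].
move=> x.
have dab : is_derive x 1 (fun y => a * y + b) a.
  have := is_deriveD (is_deriveZ a (is_derive_id x (1:R))) (is_derive_cst b x 1).
  by rewrite addr0 /GRing.scale/= mulr1.
have := @is_derive1_comp R f (fun y => a * y + b) x _ _ (df _) dab.
by rewrite mulrC.
Qed.

(** The family x^(-n) exp(-1/x), extended by 0 to x <= 0, is stable under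
    differentiation up to linear combinations, which is why the smoothness of
    its member [n = 0] is proved for the whole family at once. *)
Definition flat n x : R := if 0 < x then x^-1 ^+ n * expR (- x^-1) else 0.

Lemma flat_ge0 n x : 0 <= flat n x.
Proof.
rewrite /flat; case: ifPn => // x0.
by rewrite mulr_ge0 ?expR_ge0// exprn_ge0// invr_ge0 ltW.
Qed.

Lemma flat_gt0 n x : 0 < x -> 0 < flat n x.
Proof. by move=> x0; rewrite /flat x0 mulr_gt0 ?expR_gt0// exprn_gt0// invr_gt0. Qed.

Lemma flat_le0 n x : x <= 0 -> flat n x = 0.
Proof. by rewrite /flat ltNge => ->. Qed.

(** From exp(y) >= y^(n+1)/(n+1)! at y = 1/x.  At rank [n.+1] this bounds the
    difference quotients of [flat n] at 0. *)
Lemma flat_le n x : flat n x <= n.+1`!%:R * `|x|.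
Proof.
rewrite /flat; case: ifPn => [x0|_]; last by rewrite mulr_ge0.
rewrite gtr0_norm// expRN ler_pdivrMr ?expR_gt0//.
have y0 : 0 <= x^-1 by rewrite invr_ge0 ltW.
have := expR_ge1Dxn n y0; rewrite -lerBrDl => h.
have : x^-1 ^+ n.+1 / n.+1`!%:R <= expR x^-1.
  by rewrite (le_trans h)// gerBl.
rewrite ler_pdivrMr ?ltr0n ?fact_gt0// => {}h.
have -> : x^-1 ^+ n = x * x^-1 ^+ n.+1.
  by rewrite exprS mulrA divff ?mul1r// gt_eqF.
by rewrite (mulrC _ x) -mulrA ler_pM2l// mulrC.
Qed.

Lemma is_derive_flat n x :
  is_derive x 1 (flat n) (- n%:R * flat n.+1 x + flat n.+2 x).
Proof.
have [x0|x0|->] := ltgtP x 0.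
- rewrite !flat_le0 ?ltW// mulr0 addr0.
  apply: (@near_eq_is_derive _ _ _ (cst 0)).
  by near=> y; rewrite flat_le0// ltW//; near: y; exact: lt_nbhsl.
- apply: (@near_eq_is_derive R R R (fun y : R => y^-1 ^+ n * expR (- y^-1))).
    near=> y; rewrite /flat ifT//; near: y; exact: lt_nbhsr.
  have dV : is_derive x 1 (fun y : R => y^-1) (- x ^- 2).
    have := @is_deriveV R id x 1 1 _ (is_derive_id x 1).
    by rewrite /GRing.scale/= mulr1; apply; rewrite gt_eqF.
  have dE : is_derive x 1 (fun y : R => expR (- y^-1)) (expR (- x^-1) * x ^- 2).
    have := @is_derive1_comp R expR (fun y : R => - y^-1) x _ _
      (is_derive_expR _) (is_deriveN dV).
    by rewrite opprK.
  have -> : (fun y : R => y^-1 ^+ n * expR (- y^-1)) =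
      (fun y : R => y^-1) ^+ n * (fun y => expR (- y^-1)).
    by apply/funext => y; rewrite /= !fctE.
  apply: is_derive_eq (is_deriveM (is_deriveX n dV) dE) _.
  rewrite exprfctE /GRing.scale/= /flat x0.
  case: n => [|n] /=; rewrite !exprS ?expr0; field; by rewrite gt_eqF.
- rewrite !flat_le0// mulr0 addr0.
  suff H : (fun h : R => h^-1 *: ((flat n \o shift 0) (h *: 1) - flat n 0))
      @ 0^' --> (0 : R).
    apply: DeriveDef; first by apply/cvg_ex; exists 0.
    exact: cvg_lim H.
  apply: (@cvg_to_0_linear _ _ (n.+2`!%:R) 1) => // h /andP[h0 _].
  rewrite /= /GRing.scale/= mulr1 addr0 (flat_le0 n (lexx 0)) subr0.
  rewrite (le_trans _ (flat_le n.+1 h))// /flat.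
  case: ifPn => hp; last by rewrite mulr0 normr0.
  rewrite mulrA -exprS ger0_norm// mulr_ge0 ?expR_ge0//.
  by rewrite exprn_ge0// invr_ge0 ltW.
Unshelve. all: by end_near. Qed.

Lemma ndiff_flat m n : ndiff m (flat n).
Proof.
elim: m n => // m IH n.
exists (((fun=> - n%:R) \* flat n.+1) \+ flat n.+2).
  by move=> x; exact: is_derive_flat.
by apply: ndiffD => //; apply: ndiffM => //; exact: ndiff_cst.
Qed.

(** The usual smooth transition from 0 (for x <= 0) to 1 (for x >= 1). *)
Definition step x := flat 0 x / (flat 0 x + flat 0 (1 - x)).

Let den_gt0 x : 0 < flat 0 x + flat 0 (1 - x).
Proof.
have [x0|x0] := ltP 0 x; first by rewrite ltr_pwDl ?flat_gt0 ?flat_ge0.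
by rewrite ltr_wpDl ?flat_ge0// flat_gt0// subr_gt0 (le_lt_trans x0).
Qed.

Lemma step0 x : x <= 0 -> step x = 0.
Proof. by move=> x0; rewrite /step flat_le0// mul0r. Qed.

Lemma step1 x : 1 <= x -> step x = 1.
Proof.
move=> x1; rewrite /step [flat 0 (1 - x)]flat_le0 ?subr_le0// addr0 divff//.
by rewrite gt_eqF// flat_gt0// (lt_le_trans _ x1).
Qed.

Lemma step_itv x : 0 <= step x <= 1.
Proof.
apply/andP; split; rewrite /step; first by rewrite divr_ge0 ?flat_ge0 ?ltW ?den_gt0.
by rewrite ler_pdivrMr ?den_gt0// mul1r lerDl flat_ge0.
Qed.

Lemma ndiff_step n : ndiff n step.
Proof.
have s1 : ndiff n (fun x => flat 0 (1 - x)).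
  have := ndiff_affine (-1) 1 (ndiff_flat n 0).
  by congr ndiff; apply/funext => x; rewrite mulN1r addrC.
apply: ndiffM; first exact: ndiff_flat.
apply: ndiffV => [x|]; first by rewrite gt_eqF.
by apply: ndiffD => //; exact: ndiff_flat.
Qed.

Lemma step_derive_ge0 x : 0 <= derive1 step x.
Proof.
have d0 (y : R) : is_derive y 1 (flat 0) (flat 2 y).
  by have := is_derive_flat 0 y; rewrite oppr0 mul0r add0r.
have d1 : is_derive x 1 (fun y => flat 0 (1 - y)) (- flat 2 (1 - x)).
  have := @is_derive1_comp R (flat 0) (fun y => 1 - y) x _ _ (d0 _)
    (is_deriveB (is_derive_cst (1 : R) x 1) (is_derive_id x 1)).
  by rewrite sub0r mulrN1.
have dV : is_derive x 1 (fun y => (flat 0 y + flat 0 (1 - y))^-1) _ :=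
  @is_deriveV R (fun y => flat 0 y + flat 0 (1 - y)) x _ 1
    (lt0r_neq0 (den_gt0 x)) (is_deriveD (d0 x) d1).
have := is_deriveM (d0 x) dV.
rewrite derive1E => ?; rewrite derive_val /GRing.scale/=.
set A := flat 0 x; set B := flat 0 (1 - x).
set A' := flat 2 x; set B' := flat 2 (1 - x).
have AB : 0 < A + B := den_gt0 x.
suff -> : A * (- (A + B) ^- 2 * (A' + - B')) + (A + B)^-1 * A'
   = (A' * B + A * B') / (A + B) ^+ 2.
  by rewrite divr_ge0 ?sqr_ge0// addr_ge0// mulr_ge0// flat_ge0.
by field; rewrite gt_eqF.
Qed.

End smooth_step.

(** * Growth bounds from weak derivatives *)

Section weak_mean_value.
Context {R : realType}.
Notation mu := (@lebesgue_measure R).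
Implicit Types (w dw : R -> R) (a b c h x T C : R).

Lemma lebesgue_aeS (P Q : R -> Prop) : (forall x, P x -> Q x) ->
  {ae mu, forall x, P x} -> {ae mu, forall x, Q x}.
Proof. by move=> PQ; apply: filterS => //; exact: (ae_filter_ringOfSetsType mu). Qed.

Lemma ae_le_Rintegral (D : set R) (f g : R -> R) : measurable D ->
  mu.-integrable D (EFin \o f) -> mu.-integrable D (EFin \o g) ->
  {ae mu, forall x, D x -> f x <= g x} ->
  \int[mu]_(x in D) f x <= \int[mu]_(x in D) g x.
Proof.
move=> mD fi gi fg; rewrite -subr_ge0 -RintegralB//.
have mgf : measurable_fun D (fun x => g x - f x).
  by apply: measurable_funB; apply/measurable_EFinP; exact: (measurable_int mu).
(* an everywhere nonnegative representative of g - f *)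
have -> : \int[mu]_(x in D) (g x - f x) =
    \int[mu]_(x in D) Num.max (g x - f x) 0.
  congr fine; apply: ae_eq_integral => //.
  - exact/measurable_EFinP.
  - by apply/measurable_EFinP; exact: measurable_maxr.
  - apply: (lebesgue_aeS _ fg) => x fgx Dx; congr EFin.
    by rewrite max_l// subr_ge0 fgx.
by apply: Rintegral_ge0 => x _; rewrite le_max lexx orbT.
Qed.

Lemma continuous_itv_integrable T w : {within `[0, T], continuous w} ->
  mu.-integrable `]0, T[ (EFin \o w).
Proof.
move=> cw; apply: (@integrableS _ _ _ mu `[0, T]) => //.
  exact: subset_itv_oo_cc.
by apply: continuous_compact_integrable => //; exact: segment_compact.
Qed.

(** [step] transported to the window [c, c + h].  Its derivative is a smooth
    nonnegative bump supported there. *)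
Definition ramp c h x := step (h^-1 * x + - (c / h)).

Lemma ramp0 c h x : 0 < h -> x <= c -> ramp c h x = 0.
Proof.
move=> h0 xc; rewrite /ramp step0//.
by rewrite mulrC subr_le0 ler_pM2r ?invr_gt0.
Qed.

Lemma ramp1 c h x : 0 < h -> c + h <= x -> ramp c h x = 1.
Proof.
move=> h0 xc; rewrite /ramp step1//.
by rewrite mulrC -mulrBl ler_pdivlMr// mul1r; lra.
Qed.

Lemma ramp_itv c h x : 0 <= ramp c h x <= 1.
Proof. exact: step_itv. Qed.

Lemma ndiff_ramp n c h : ndiff n (ramp c h).
Proof. exact/ndiff_affine/ndiff_step. Qed.

Lemma derivable_ramp c h x : derivable (ramp c h) x 1.
Proof. exact: (ndiff_derivable (ndiff_ramp 1 c h)). Qed.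

Lemma continuous_derive_ramp c h : continuous (derive1 (ramp c h)).
Proof.
move=> x; apply/differentiable_continuous/derivable1_diffP.
exact: (ndiff_derivable (ndiff_ramp 2 c h)).
Qed.

Lemma derive_ramp_ge0 c h x : 0 < h -> 0 <= derive1 (ramp c h) x.
Proof.
move=> h0.
have dab : is_derive x 1 (fun y => h^-1 * y + - (c / h)) h^-1.
  have := is_deriveD (is_deriveZ h^-1 (is_derive_id x (1:R)))
    (is_derive_cst (- (c / h)) x 1).
  by rewrite addr0 /GRing.scale/= mulr1.
rewrite /ramp (@derive1_comp _ (fun y => h^-1 * y + - (c / h)) step).
- rewrite [X in _ * X]derive1E derive_val.
  by rewrite mulr_ge0// ?step_derive_ge0// invr_ge0 ltW.
- by [].
- exact: (ndiff_derivable (ndiff_step 1)).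
Qed.

Lemma derive_ramp_out c h x : 0 < h -> x < c \/ c + h < x ->
  derive1 (ramp c h) x = 0.
Proof.
move=> h0 xch; rewrite derive1E.
have [k hk] : exists k, \near x, ramp c h x = cst k x.
  case: xch => xc.
    exists 0; near=> y; rewrite ramp0// ltW//; near: y; exact: lt_nbhsl.
  exists 1; near=> y; rewrite ramp1// ltW//; near: y; exact: lt_nbhsr.
by rewrite (near_eq_derive _ hk) derive_cst.
Unshelve. all: by end_near. Qed.

Lemma integral_derive_ramp c h T : 0 < h -> 0 <= c -> c + h <= T ->
  \int[mu]_(x in `]0, T[) derive1 (ramp c h) x = 1.
Proof.
move=> h0 c0 cT; have T0 : 0 < T by lra.
have cd : {within `[0, T], continuous (derive1 (ramp c h))}.
  exact/continuous_subspaceT/continuous_derive_ramp.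
have cr x : ramp c h y @[y --> x] --> ramp c h x.
  exact/differentiable_continuous/derivable1_diffP/derivable_ramp.
rewrite Rintegral_itv_bndo_bndc ?Rintegral_itv_obnd_cbnd//.
- rewrite /Rintegral (@continuous_FTC2 _ _ (ramp c h))//.
    by rewrite /= ramp1// ramp0// subr0.
  split => [x _||]; first exact: derivable_ramp.
  + exact/cvg_at_right_filter/cr.
  + exact/cvg_at_left_filter/cr.
- apply: (@integrableS _ _ _ mu `[0, T]) => //.
    exact: subset_itv_oc_cc.
  by apply: continuous_compact_integrable => //; exact: segment_compact.
- exact: continuous_itv_integrable.
Qed.

(** The derivative of a ramp is nonnegative, vanishes off the window and has
    integral 1, so integrating against it is taking a weighted average over the
    window. *)
Lemma integral_mul_derive_ramp w c h T m M : 0 < h -> 0 <= c -> c + h <= T ->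
  {within `[0, T], continuous w} ->
  (forall x, c <= x <= c + h -> m <= w x <= M) ->
  m <= \int[mu]_(x in `]0, T[) (w x * derive1 (ramp c h) x) <= M.
Proof.
move=> h0 c0 cT cw wmM.
have cd : {within `[0, T], continuous (derive1 (ramp c h))}.
  exact/continuous_subspaceT/continuous_derive_ramp.
have di := continuous_itv_integrable cd.
have wdi : mu.-integrable `]0, T[ (EFin \o (fun x => w x * derive1 (ramp c h) x)).
  by apply: continuous_itv_integrable => x; apply: cvgM; [exact: cw|exact: cd].
have kdi k : mu.-integrable `]0, T[ (EFin \o (fun x => k * derive1 (ramp c h) x)).
  by apply: continuous_itv_integrable => x; apply: cvgM; [exact: cvg_cst|exact: cd].
have E k : k = \int[mu]_(x in `]0, T[) (k * derive1 (ramp c h) x).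
  by rewrite RintegralZl// integral_derive_ramp// mulr1.
have B x : m * derive1 (ramp c h) x <= w x * derive1 (ramp c h) x
           <= M * derive1 (ramp c h) x.
  have [xc|cx] := ltP x c; first by rewrite derive_ramp_out ?mulr0 ?lexx//; left.
  have [xc|xc] := ltP (c + h) x.
    by rewrite derive_ramp_out ?mulr0 ?lexx//; right.
  have /andP[mw wM] : m <= w x <= M by apply: wmM; rewrite cx.
  by rewrite !ler_wpM2r ?derive_ramp_ge0.
by apply/andP; split; [rewrite [leLHS]E|rewrite [leRHS]E];
  apply: le_Rintegral => // x _; have /andP[] := B x.
Qed.

(** The real-valued counterpart of [test_function]. *)
Definition scalar_test (I : set R) (phi : R -> R) :=
  (forall n x, derivable (derive1n n phi) x 1) /\
  (exists K, [/\ compact K, K `<=` I & forall x, ~ K x -> phi x = 0]).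

(** The test function is a plateau phi rising on [a + h, a + 2h] and falling on
    [b - 2h, b - h].  Up to an error e, the integral of w * phi' is w a - w b,
    and that of dw * phi is at most C * (b - a) because 0 <= phi <= 1. *)
Lemma weak_mean_value_le w dw T a b C : 0 <= a -> a < b -> b <= T -> 0 <= C ->
  {within `[0, T], continuous w} ->
  mu.-integrable `]0, T[ (EFin \o dw) ->
  (forall phi, scalar_test `]0, T[ phi ->
    \int[mu]_(x in `]0, T[) (w x * derive1 phi x) =
    - \int[mu]_(x in `]0, T[) (dw x * phi x)) ->
  {ae mu, forall x, a < x < b -> dw x <= C} ->
  w b - w a <= C * (b - a).
Proof.
move=> a0 ab bT C0 cw dwi wk dwC.
have T0 : 0 < T by lra.
have /continuous_within_itvP-/(_ ab)[_ cwa cwb] : {within `[a, b], continuous w}.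
  apply: continuous_subspaceW cw => x /=; rewrite !in_itv/=; lra.
apply/ler_addgt0Pr => e e0; pose d := e / 2.
have d0 : 0 < d by rewrite divr_gt0.
have conclude (x y z : R) : x <= w a + d -> w b - d <= y ->
    z <= C * (b - a) -> x - y = - z -> w b - w a <= C * (b - a) + e.
  by rewrite /d; lra.
(* 4 * h <= b - a keeps the rising window to the left of the falling one. *)
have [h [h0 hab ha hb]] : exists h, [/\ 0 < h, 4 * h <= b - a,
   forall x, a + h <= x <= a + 2 * h -> w a - d <= w x <= w a + d &
   forall x, b - 2 * h <= x <= b - h -> w b - d <= w x <= w b + d].
  move/cvgrPdist_le : cwa => /(_ _ d0) [r1 /= r10 hr1].
  move/cvgrPdist_le : cwb => /(_ _ d0) [r2 /= r20 hr2].
  pose h := Num.min ((b - a) / 4) (Num.min (r1 / 4) (r2 / 4)).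
  have h1 : h <= (b - a) / 4 by rewrite /h ge_min lexx.
  have h2 : h <= r1 / 4 by rewrite /h !ge_min lexx orbT.
  have h3 : h <= r2 / 4 by rewrite /h !ge_min lexx !orbT.
  have h0 : 0 < h by rewrite /h !lt_min; apply/and3P; split; lra.
  exists h; split => //; first by lra.
  - move=> x hx; have := hr1 x; rewrite /ball_/= !ler_norml.
    have -> : `|a - x| < r1 by rewrite ltr_norml; lra.
    by move=> /(_ erefl); (have -> : a < x by lra); move=> /(_ erefl); lra.
  - move=> x hx; have := hr2 x; rewrite /ball_/= !ler_norml.
    have -> : `|b - x| < r2 by rewrite ltr_norml; lra.
    by move=> /(_ erefl); (have -> : x < b by lra); move=> /(_ erefl); lra.
pose P := ramp (a + h) h; pose Q := ramp (b - 2 * h) h.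
pose phi := P \- Q.
have dPQ : derive1 phi = derive1 P \- derive1 Q.
  apply/funext => x; rewrite derive1E [LHS]deriveB; first by rewrite /= !derive1E.
    exact: derivable_ramp.
  exact: derivable_ramp.
have phi0 x : x <= a + h \/ b - h <= x -> phi x = 0.
  case=> hx; rewrite /phi /P /Q /=.
    by rewrite !ramp0 ?subrr//; lra.
  by rewrite !ramp1 ?subrr//; lra.
have phi01 x : 0 <= phi x <= 1.
  rewrite /phi /P /Q /=.
  have := ramp_itv (a + h) h x; have := ramp_itv (b - 2 * h) h x.
  have [hx|hx] := leP x (a + 2 * h).
    by rewrite [ramp (b - _) _ _]ramp0//; lra.
  by rewrite [ramp (a + _) _ _]ramp1//; lra.
have phiC n : ndiff n phi.
  have -> : phi = P \+ ((fun=> -1) \* Q) by apply/funext => x; rewrite /= mulN1r.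
  by apply: ndiffD; [|apply: ndiffM; first exact: ndiff_cst]; exact: ndiff_ramp.
have cphi : continuous phi.
  move=> x; apply/differentiable_continuous/derivable1_diffP.
  exact: (ndiff_derivable (phiC 1)).
have phiT : scalar_test `]0, T[ phi.
  split => [n x|]; first exact: ndiff_derivable.
  exists `[a + h, b - h]%classic; split; first exact: segment_compact.
    move=> x /=; rewrite !in_itv/=; lra.
  move=> x /negP; rewrite in_itv/= negb_and -!ltNge => hx; apply: phi0.
  by case/orP: hx => /ltW; [left|right].
have dwphii : mu.-integrable `]0, T[ (EFin \o (fun x => dw x * phi x)).
  apply: (le_integrable _ _ _ dwi) => //.
    apply/measurable_EFinP/measurable_funM.
      by apply/measurable_EFinP; exact: (measurable_int mu dwi).
    apply: measurable_funTS. exact: continuous_measurable_fun.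
  move=> x _ /=; rewrite lee_fin normrM -[leRHS]mulr1 ler_wpM2l//.
  by rewrite ler_norml; have := phi01 x; lra.
have sab : `]a, b[ `<=` `]0, T[ by move=> x /=; rewrite !in_itv/=; lra.
have up : \int[mu]_(x in `]0, T[) (dw x * phi x) <= C * (b - a).
  have -> : \int[mu]_(x in `]0, T[) (dw x * phi x) =
      \int[mu]_(x in `]a, b[) (dw x * phi x).
    rewrite -(setIidr sab) Rintegral_mkcondr; apply: eq_Rintegral => x _.
    rewrite patchE; case: ifPn => //; rewrite notin_setE /= in_itv/= => /negP.
    rewrite negb_and -!leNgt => hx; rewrite phi0 ?mulr0//.
    by case/orP: hx; [left|right]; lra.
  have -> : C * (b - a) = \int[mu]_(x in `]a, b[) C.
    by rewrite Rintegral_cst//= lebesgue_measure_itv/= lte_fin ab.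
  apply: ae_le_Rintegral => //.
  - exact: integrableS dwphii.
  - apply: (@integrableS _ _ _ mu `]0, T[) => //.
    by apply: continuous_itv_integrable; apply: continuous_subspaceT => x; exact: cvg_cst.
  - apply: (lebesgue_aeS _ dwC) => x {}dwC /=; rewrite in_itv/= => /dwC dwxC.
    have /andP[p0 p1] := phi01 x.
    apply: (le_trans (ler_wpM2r p0 dwxC)).
    by rewrite -[leRHS]mulr1 ler_wpM2l.
have /andP[_ hP] : w a - d <= \int[mu]_(x in `]0, T[) (w x * derive1 P x) <= w a + d.
  apply: integral_mul_derive_ramp => //; try lra.
  by move=> x hx; apply: ha; lra.
have /andP[hQ _] : w b - d <= \int[mu]_(x in `]0, T[) (w x * derive1 Q x) <= w b + d.
  apply: integral_mul_derive_ramp => //; try lra.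
  by move=> x hx; apply: hb; lra.
have := wk _ phiT.
have -> : \int[mu]_(x in `]0, T[) (w x * derive1 phi x) =
    \int[mu]_(x in `]0, T[) (w x * derive1 P x) -
    \int[mu]_(x in `]0, T[) (w x * derive1 Q x).
  rewrite -RintegralB//.
  - by apply: eq_Rintegral => x _; rewrite dPQ mulrBr.
  - apply: continuous_itv_integrable => x; apply: cvgM; first exact: cw.
    by apply: continuous_subspaceT; exact: continuous_derive_ramp.
  - apply: continuous_itv_integrable => x; apply: cvgM; first exact: cw.
    by apply: continuous_subspaceT; exact: continuous_derive_ramp.
exact: conclude hP hQ up.
Qed.

End weak_mean_value.

(** * A maximum principle for weak differential inequalities *)

Section maximum_principle.
Context {R : realType}.
Notation mu := (@lebesgue_measure R).

Lemma last_nonpositive (f : R -> R) (c : R) : 0 <= c ->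
  {within `[0, c], continuous f} -> f 0 <= 0 -> 0 < f c ->
  exists s, [/\ 0 <= s, s < c, f s <= 0 & forall x, s < x <= c -> 0 < f x].
Proof.
move=> c0 cf f0 fc.
pose A := [set x | 0 <= x <= c /\ f x <= 0].
have A0 : A 0 by split; rewrite ?lexx.
have ubA : has_ubound A by exists c => x [/andP[]].
have supA : has_sup A by split => //; exists 0.
pose s := sup A.
have s0 : 0 <= s by exact: ub_le_sup A0.
have sc : s <= c by apply: ge_sup => [|x [/andP[]]//]; exists 0.
have after x : s < x <= c -> 0 < f x.
  move=> /andP[sx xc]; rewrite ltNge; apply/negP => fx.
  have : x <= s by apply: ub_le_sup => //; split => //; rewrite xc (le_trans s0 (ltW sx)).
  by rewrite leNgt sx.
have fs : f s <= 0.
  rewrite leNgt; apply/negP => fs.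
  have /subspace_continuousP/(_ s) := cf.
  rewrite /= in_itv/= s0 sc => /(_ erefl)/cvgrPdist_lt/(_ _ fs)[e /= e0 he].
  have [x [/andP[x0 xc] fx] sx] := sup_adherent e0 supA.
  have xs : x <= s by apply: ub_le_sup => //; split => //; rewrite x0.
  have := he x; rewrite /= in_itv/= x0 xc /ball_/= => /(_ _ isT).
  rewrite -/s in sx.
  have -> : `|s - x| < e by rewrite ger0_norm ?subr_ge0// ltrBlDr -ltrBlDl.
  by rewrite ltr_norml ltrBlDr => /(_ isT)/andP[_]; rewrite ltrDl ltNge fx.
exists s; split => //; rewrite lt_neqAle sc andbT.
by apply: contraTneq fc => <-; rewrite -leNgt.
Qed.

(** The hypothesis says that a positive component grows at most at rate K times
    the maximum of all components.  The induction advances by time steps of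
    length d = 1/(2K), over which a maximum S built up from 0 would satisfy
    S <= S / 2. *)
Lemma weak_maximum_principle (I : finType) (w dw : R -> I -> R) (T K : R) :
  0 < K ->
  (forall i, {within `[0, T], continuous (w ^~ i)}) ->
  (forall i, mu.-integrable `]0, T[ (EFin \o (dw ^~ i))) ->
  (forall i phi, scalar_test `]0, T[ phi ->
    \int[mu]_(t in `]0, T[) (w t i * derive1 phi t) =
    - \int[mu]_(t in `]0, T[) (dw t i * phi t)) ->
  {ae mu, forall t, 0 < t < T -> forall i S, 0 < w t i ->
    (forall j, w t j <= S) -> dw t i <= K * S} ->
  (forall i, w 0 i <= 0) ->
  forall t i, 0 <= t <= T -> w t i <= 0.
Proof.
move=> K0 cw dwi wk dwle w0.
pose d := (2 * K)^-1; have d0 : 0 < d by rewrite invr_gt0 mulr_gt0.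
have Kd : K * d = 1 / 2 by rewrite /d; field; rewrite gt_eqF.
suff main n t i : 0 <= t <= T -> t <= n%:R * d -> w t i <= 0.
  move=> t i tT; apply: (main (Num.bound (t / d))) => //.
  have /andP[t0 _] := tT.
  by rewrite -ler_pdivrMr// ltW// archi_boundP// divr_ge0// ltW.
elim: n t i => [|n IH] t i tT tn.
  suff -> : t = 0 by exact: w0.
  by apply/eqP; rewrite eq_le; move: tT tn; rewrite mul0r => /andP[-> _] ->.
rewrite leNgt; apply/negP => wti.
have /andP[t0 leT] := tT.
have st : `[0, t] `<=` `[0, T] by apply: subset_itvl; rewrite bnd_simp.
have /choice[c hc] j : exists c, 0 <= c <= t /\
    forall x, 0 <= x <= t -> w x j <= w c j.
  have [c] := EVT_max t0 (continuous_subspaceW st (cw j)).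
  by rewrite in_itv/= => c0t maxc; exists c; split.
(* S is the maximum of w over [0, t] and all components, attained at time c j
   by component j. *)
pose j := [arg max_(k > i) w (c k) k]%O; pose S := w (c j) j.
have wS x k : 0 <= x <= t -> w x k <= S.
  move=> x0t; rewrite (le_trans ((hc k).2 _ x0t))//.
  by rewrite /S /j; case: arg_maxP => // m _; apply.
have S0 : 0 < S by rewrite (lt_le_trans wti)// wS// t0 lexx.
have /andP[cj0 cjt] := (hc j).1.
have scT : `[0, c j] `<=` `[0, T].
  by apply: subset_itvl; rewrite bnd_simp (le_trans cjt).
have [s [s0 scj ws wpos]] := last_nonpositive cj0
  (continuous_subspaceW scT (cw j)) (w0 j) S0.
(* The component j is nonpositive at time n * d, hence c j - s <= d. *)
have ns : n%:R * d <= s.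
  rewrite leNgt; apply/negP => sn.
  have [cn|nc] := leP (c j) (n%:R * d).
    suff : S <= 0 by rewrite leNgt S0.
    by apply: IH cn; rewrite cj0 (le_trans cjt).
  have : 0 < w (n%:R * d) j by apply: wpos; rewrite sn ltW.
  rewrite ltNge IH//.
  by rewrite (le_trans s0 (ltW sn))/= (le_trans (ltW nc))// (le_trans cjt).
have csd : c j - s <= d.
  by move: tn; rewrite -natr1 mulrDl mul1r; lra.
have : w (c j) j - w s j <= K * S * (c j - s).
  apply: (weak_mean_value_le s0 scj (le_trans cjt leT) _ (cw j) (dwi j) (wk j)).
    by rewrite mulr_ge0 ?ltW.
  apply: (lebesgue_aeS _ dwle) => x hx /andP[sx xc].
  apply: hx; first by lra.
    by apply: wpos; rewrite sx ltW.
  by move=> k; apply: wS; lra.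
rewrite -/S.
have : K * S * (c j - s) <= S / 2.
  have -> : S / 2 = K * S * d by rewrite mulrAC Kd; ring.
  by rewrite ler_pM2l// mulr_gt0.
by lra.
Qed.

End maximum_principle.

(** * Components of graph-valued weak derivatives *)

Section weak_derivative_components.
Context {R : realType}.
Notation mu := (@lebesgue_measure R).

Lemma C0_component (G : wgraph R) (I : set R) (u : R -> G -> R) :
  C0 I u -> forall i, {within I, continuous (u ^~ i)}.
Proof.
move=> cu i t.
exact: (@continuous_comp _ _ _ (u : subspace I -> {ptws G -> R})
  (fun f : {ptws G -> R} => f i) t (cu t) (@proj_continuous _ (fun=> R) i _)).
Qed.

(** Square integrability on a bounded interval gives integrability, by
    |x| <= 1 + x^2. *)
Lemma L2_integrable (G : wgraph R) (r T : R) (u : R -> G -> R) :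
  L2 r `]0, T[ u -> forall i, mu.-integrable `]0, T[ (EFin \o (u ^~ i)).
Proof.
move=> [mu_ uoo] i; set D := degree i `^ r.
have D0 (j : G) : 0 < degree j `^ r by rewrite powR_gt0// degree_gt0.
have vi : mu.-integrable `]0, T[ (EFin \o (fun t => vdot r (u t) (u t))).
  apply/integrableP; split.
    apply/measurable_EFinP; apply: measurable_sum => j.
    exact: measurable_funM (measurable_funM (mu_ j) (mu_ j)) (measurable_cst _).
  apply: le_lt_trans uoo; rewrite le_eqVlt; apply/orP; left.
  apply/eqP; apply: eq_integral => t _ /=.
  rewrite ger0_norm// sumr_ge0// => j _.
  by rewrite mulr_ge0 ?powR_ge0// -expr2 sqr_ge0.
have ci : mu.-integrable `]0, T[ (EFin \o (fun=> 1 : R)).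
  by apply: continuous_itv_integrable; apply: continuous_subspaceT => x; exact: cvg_cst.
apply: (le_integrable _ _ _
  (integrableD _ ci (integrableZl _ D^-1 vi))) => //.
  by apply/measurable_EFinP; exact: mu_.
move=> t _; rewrite /= lee_fin.
set V := vdot r (u t) (u t).
have uV : u t i ^+ 2 * D <= V.
  rewrite /V /vdot (bigD1 i)//= -expr2 lerDl sumr_ge0// => j _.
  by rewrite mulr_ge0 ?powR_ge0// -expr2 sqr_ge0.
have {}uV : u t i ^+ 2 <= D^-1 * V by rewrite mulrC ler_pdivlMr// D0.
rewrite (le_trans _ (ler_norm _))// (le_trans _ (lerD (lexx 1) uV))//.
by rewrite -real_normK ?num_real//; have := normr_ge0 (u t i); nra.
Qed.

Lemma integrable_mul_test (T : R) (f phi : R -> R) :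
  mu.-integrable `]0, T[ (EFin \o f) -> continuous phi ->
  mu.-integrable `]0, T[ (EFin \o (fun t => f t * phi t)).
Proof.
move=> fi cphi; apply: (integrableMl _ fi) => //.
  by apply: measurable_funTS; exact: continuous_measurable_fun.
have [M [Mr HM]] := compact_bounded (continuous_compact
   (continuous_subspaceT cphi) (@segment_compact R 0 T)).
exists M; split => // x Mx t tT; apply: HM => //; exists t => //.
exact: subset_itv_oo_cc tT.
Qed.

(** Testing against a function supported at the single vertex [i] isolates that
    component, multiplied by the nonzero weight of [i] in the inner product. *)
Lemma weak_derivative_component (G : wgraph R) (r T : R) (u du : R -> G -> R)
    (i : G) (phi : R -> R) :
  C0 `[0, T] u -> weak_derivative r `]0, T[ u du -> scalar_test `]0, T[ phi ->
  \int[mu]_(t in `]0, T[) (u t i * derive1 phi t) =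
  - \int[mu]_(t in `]0, T[) (du t i * phi t).
Proof.
move=> cu [duL2 dup] [phiS [K [cK KT phi0]]].
have cphi n : continuous (derive1n n phi).
  by move=> x; apply/differentiable_continuous/derivable1_diffP/phiS.
pose Phi t j := if j == i then phi t else 0.
have PhiE (j : G) : Phi ^~ j = if j == i then phi else cst 0.
  by rewrite /Phi; case: ifP.
have dPhiE t j : time_derive Phi t j = if j == i then derive1 phi t else 0.
  by rewrite /time_derive PhiE; case: ifP => // _; rewrite derive1_cst.
have vdotE (f g : G -> R) : (forall j, j != i -> g j = 0) ->
    vdot r f g = f i * g i * degree i `^ r.
  move=> g0; rewrite /vdot (bigD1 i)//= big1 ?addr0// => j ji.
  by rewrite g0// mulr0 mul0r.
have /dup : test_function `]0, T[ Phi.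
  split; last first.
    by exists K; split => // t Kt j; rewrite /Phi; case: ifP => // _; exact: phi0.
  move=> j n t; rewrite PhiE; case: ifP => // _.
  exact: (ndiff_derivable (ndiff_cst n.+1 0)).
have ui := continuous_itv_integrable (C0_component (i := i) cu).
have dui := L2_integrable duL2 i.
have Du : \int[mu]_(t in `]0, T[) vdot r (u t) (time_derive Phi t) =
    \int[mu]_(t in `]0, T[) (u t i * derive1 phi t) * degree i `^ r.
  rewrite -RintegralZr//; last exact: integrable_mul_test ui (cphi 1).
  apply: eq_Rintegral => t _; rewrite vdotE ?dPhiE ?eqxx// => j /negbTE ji.
  by rewrite dPhiE ji.
have Ddu : \int[mu]_(t in `]0, T[) vdot r (du t) (Phi t) =
    \int[mu]_(t in `]0, T[) (du t i * phi t) * degree i `^ r.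
  rewrite -RintegralZr//; last exact: integrable_mul_test dui (cphi 0).
  apply: eq_Rintegral => t _; rewrite vdotE /Phi ?eqxx// => j /negbTE ji.
  by rewrite ji.
rewrite Du Ddu -mulNr => /mulIf; apply.
by rewrite gt_eqF// powR_gt0// degree_gt0.
Qed.

End weak_derivative_components.

(** * The comparison on a graph *)

Section graph_comparison.
Context {R : realType} (G : wgraph R) (r : R).

Lemma weight_ge0 (i j : G) : 0 <= weight i j.
Proof.
by have [/weight_gt0/ltW|/weight_eq0->] := boolP (edge i j).
Qed.

Lemma laplacianB_ge (f g : G -> R) (S : R) (i : G) :
  g i <= f i -> (forall j, f j - g j <= S) ->
  - (degree i `^ (- r) * degree i * S) <= laplacian r f i - laplacian r g i.
Proof.
move=> gf fgS; rewrite /laplacian -mulrBr -mulrA -mulrN.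
rewrite ler_wpM2l ?powR_ge0// -sumrB /degree mulr_suml -sumrN ler_sum// => j _.
rewrite -mulrBr -mulrN ler_wpM2l ?weight_ge0//.
by have := fgS j; lra.
Qed.

Lemma Bset_ge0 (f alpha : G -> R) (i : G) :
  Bset f alpha -> 0 <= f i < 1 -> 0 <= alpha i.
Proof.
move=> /(_ i)[al0 al _] /andP[]; rewrite le_eqVlt => /predU1P[/esym/al0//|f0] f1.
by rewrite al// f0.
Qed.

Lemma Bset_le0 (f alpha : G -> R) (i : G) :
  Bset f alpha -> 0 < f i <= 1 -> alpha i <= 0.
Proof.
move=> /(_ i)[_ al al1] /andP[f0]; rewrite le_eqVlt => /predU1P[/al1//|f1].
by rewrite al// f0.
Qed.

(** Where v exceeds u at a vertex, u is off the upper obstacle and v off the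
    lower one, so that both multipliers have the favourable sign there. *)
Lemma obstacle_rate_le (eps S : R) (u v du dv beta gamma : G -> R) (i : G) :
  0 < eps -> 0 <= u i <= 1 -> 0 <= v i <= 1 ->
  eps * du i + eps * laplacian r u i + 1 / 2 - u i >= beta i -> Bset u beta ->
  eps * dv i + eps * laplacian r v i + 1 / 2 - v i <= gamma i -> Bset v gamma ->
  0 < v i - u i -> (forall j, v j - u j <= S) ->
  dv i - du i <= (eps^-1 + \sum_(j : G) degree j `^ (- r) * degree j) * S.
Proof.
move=> eps0 u01 v01 hu bu hv bv vu vuS.
have b0 : 0 <= beta i by apply: (Bset_ge0 bu); lra.
have g0 : gamma i <= 0 by apply: (Bset_le0 bv); lra.
have S0 : 0 < S := lt_le_trans vu (vuS i).
have uv : u i <= v i by rewrite -subr_ge0 ltW.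
have L := laplacianB_ge uv vuS.
set k := degree i `^ (- r) * degree i in L.
have kle : k <= \sum_(j : G) degree j `^ (- r) * degree j.
  rewrite (bigD1 i)//= lerDl sumr_ge0// => j _.
  by rewrite mulr_ge0 ?powR_ge0// ltW// degree_gt0.
have kS : (eps^-1 + k) * S <=
    (eps^-1 + \sum_(j : G) degree j `^ (- r) * degree j) * S.
  by rewrite ler_pM2r// lerD2l.
apply: le_trans kS.
have main : eps * (dv i - du i) <= S + eps * (k * S).
  have := vuS i; have : eps * - (k * S) <= eps * (laplacian r v i - laplacian r u i).
    by rewrite ler_pM2l.
  by move: hu hv b0 g0; rewrite !mulrBr mulrN; lra.
have -> : (eps^-1 + k) * S = (S + eps * (k * S)) / eps.
  by field; rewrite gt_eqF.
by rewrite ler_pdivlMr// mulrC.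
Qed.

End graph_comparison.

Theorem theoremB2 (R : realType) (G : wgraph R) (r eps T : R)
  (r01 : 0 <= r <= 1) (eps_gt0 : 0 < eps) (T_gt0 : 0 < T)
  (u v du dv beta gamma : R -> G -> R)
  (uH1 : H1 r `]0, T[ u) (uC0 : C0 `[0, T] u)
  (vH1 : H1 r `]0, T[ v) (vC0 : C0 `[0, T] v)
  (duP : weak_derivative r `]0, T[ u du)
  (dvP : weak_derivative r `]0, T[ v dv)
  (u01 : forall (t : R) (i : G), 0 < t < T -> 0 <= u t i <= 1)
  (v01 : forall (t : R) (i : G), 0 < t < T -> 0 <= v t i <= 1)
  (u_super : {ae lebesgue_measure, forall t : R, 0 < t < T ->
     (forall i : G, eps * du t i + eps * laplacian r (u t) i + 1 / 2 - u t i
                    >= beta t i) /\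
     Bset (u t) (beta t)})
  (v_sub : {ae lebesgue_measure, forall t : R, 0 < t < T ->
     (forall i : G, eps * dv t i + eps * laplacian r (v t) i + 1 / 2 - v t i
                    <= gamma t i) /\
     Bset (v t) (gamma t)})
  (vu0 : forall i : G, v 0 i <= u 0 i) :
  forall (t : R) (i : G), 0 <= t <= T -> v t i <= u t i.
Proof.
have [duL2 _] := duP; have [dvL2 _] := dvP.
have cw i : {within `[0, T], continuous (fun t => v t i - u t i)}.
  by move=> t; apply: cvgB; [exact: (C0_component vC0)|exact: (C0_component uC0)].
have idu i := L2_integrable duL2 i; have idv i := L2_integrable dvL2 i.
have idw i : lebesgue_measure.-integrable `]0, T[
    (EFin \o (fun t => dv t i - du t i)).
  exact: (integrableB _ (idv i) (idu i)).
move=> t i tT; rewrite -subr_le0.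
apply: (weak_maximum_principle (w := fun t i => v t i - u t i)
  (dw := fun t i => dv t i - du t i)
  (K := eps^-1 + \sum_(j : G) degree j `^ (- r) * degree j) _ cw idw _ _ _ i tT).
- rewrite ltr_pwDl ?invr_gt0// sumr_ge0// => j _.
  by rewrite mulr_ge0 ?powR_ge0// ltW// degree_gt0.
- move=> j phi phiT.
  have cdphi : continuous (derive1 phi).
    by move=> x; apply/differentiable_continuous/derivable1_diffP/(phiT.1 1%N).
  have cphi : continuous phi.
    by move=> x; apply/differentiable_continuous/derivable1_diffP/(phiT.1 0%N).
  have iu := continuous_itv_integrable (C0_component (i := j) uC0).
  have iv := continuous_itv_integrable (C0_component (i := j) vC0).
  under eq_Rintegral do rewrite mulrBl.
  rewrite RintegralB//; [|exact: integrable_mul_test..].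
  rewrite (weak_derivative_component _ vC0 dvP phiT).
  rewrite (weak_derivative_component _ uC0 duP phiT).
  under [in RHS]eq_Rintegral do rewrite mulrBl.
  by rewrite RintegralB//; [rewrite opprB opprK addrC|exact: integrable_mul_test..].
- have uv_ae := filterI (Filter := ae_filter_ringOfSetsType lebesgue_measure)
    u_super v_sub.
  apply: (lebesgue_aeS _ uv_ae) => x [/= hu hv] xT j S vu vuS.
  have [hu1 bu] := hu xT; have [hv1 bv] := hv xT.
  by apply: (obstacle_rate_le eps_gt0 _ _ (hu1 j) bu (hv1 j) bv); auto.
- by move=> j; rewrite subr_le0.
Qed.
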